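(* Let $k\le n$, let $\Phi_{t-1},\Phi_t\in\mathbb{R}^{n\times k}$, $C_t\in\mathbb{R}^n$ and $0\le\gamma<1$, and assume that the matrices $\Phi_{t-1}$, $\Phi_{t-1}-\gamma\Phi_t$ and $\Phi_{t-1}^{\top}(\Phi_{t-1}-\gamma\Phi_t)$ have full column rank. Let $\Pi_{t-1}=\Phi_{t-1}(\Phi_{t-1}^{\top}\Phi_{t-1})^{-1}\Phi_{t-1}^{\top}$. Then the following three policy evaluation estimators are equivalent, i.e. they define the same vector $\hat\theta\in\mathbb{R}^k$: (i) (instrumental variables Bellman error minimization) $$\hat\theta=\bigl[\Phi_{t-1}^{\top}(\Phi_{t-1}-\gamma\Phi_t)\bigr]^{-1}\Phi_{t-1}^{\top}C_t;$$ (ii) (least-squares projected Bellman error minimization) $$\hat\theta=\Bigl[\bigl(\Pi_{t-1}(\Phi_{t-1}-\gamma\Phi_t)\bigr)^{\top}\bigl(\Pi_{t-1}(\Phi_{t-1}-\gamma\Phi_t)\bigr)\Bigr]^{-1}\bigl(\Pi_{t-1}(\Phi_{t-1}-\gamma\Phi_t)\bigr)^{\top}\Pi_{t-1}C_t;$$ (iii) (instrumental variables projected Bellman error minimization) $$\hat\theta=\bigl[\Phi_{t-1}^{\top}\Pi_{t-1}(\Phi_{t-1}-\gamma\Phi_t)\bigr]^{-1}\Phi_{t-1}^{\top}\Pi_{t-1}C_t.$$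
   Context: In the application, $\Phi_{t-1}$ and $\Phi_t$ are the $n\times k$ matrices whose $i$-th rows are the values $\phi(S^x_{t-1,i})^{\top}$ and $\phi(S^x_{t,i})^{\top}$ of $k$ fixed basis functions at the $i$-th sampled post-decision state and at its simulated successor post-decision state; $C_t$ is the vector of observed one-step contributions; $\gamma$ is the discount factor; and $\Pi_{t-1}$ is the Euclidean orthogonal projection onto the column span of $\Phi_{t-1}$. *)

(* Defs.v *)
From mathcomp Require Import all_boot all_order all_algebra reals.

Set Implicit Arguments.
Unset Strict Implicit.
Unset Printing Implicit Defensive.

Import GRing.Theory.
Local Open Scope ring_scope.

(* [invmx A] is the inverse of [A] when [A \in unitmx] and [A] itself otherwise,
   so the formulas below carry their intended meaning only when the matrices
   they invert are in [unitmx]. *)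

Section Estimators.
Variables (R : realType) (n k : nat).
Implicit Types (P Q : 'M[R]_(n, k)) (C : 'cV[R]_n) (gamma : R).

(* For [P] of full column rank, the orthogonal projection onto its column span. *)
Definition proj_colspan P : 'M[R]_n := P *m invmx (P^T *m P) *m P^T.

(* In the definitions below [P] is $\Phi_{t-1}$ and [Q] is $\Phi_t$. *)

Definition bellman_diff P Q gamma : 'M[R]_(n, k) := P - gamma *: Q.

Definition iv_gram P Q gamma : 'M[R]_k := P^T *m bellman_diff P Q gamma.

Definition iv_bellman P Q C gamma : 'cV[R]_k :=
  invmx (iv_gram P Q gamma) *m (P^T *m C).

Definition ls_proj_gram P Q gamma : 'M[R]_k :=
  (proj_colspan P *m bellman_diff P Q gamma)^T
    *m (proj_colspan P *m bellman_diff P Q gamma).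

Definition ls_proj_bellman P Q C gamma : 'cV[R]_k :=
  invmx (ls_proj_gram P Q gamma)
    *m ((proj_colspan P *m bellman_diff P Q gamma)^T
          *m (proj_colspan P *m C)).

Definition iv_proj_gram P Q gamma : 'M[R]_k :=
  P^T *m proj_colspan P *m bellman_diff P Q gamma.

Definition iv_proj_bellman P Q C gamma : 'cV[R]_k :=
  invmx (iv_proj_gram P Q gamma) *m (P^T *m proj_colspan P *m C).

End Estimators.

(* Main.v *)
Require Import Defs.
From mathcomp Require Import all_boot all_order all_algebra reals.

(** Write [D] for the difference P - gamma Q, [S] for P^T P and [G] for P^T D.
    The projection Pi = P S^-1 P^T satisfies P^T Pi = P^T, so premultiplying
    by P^T makes it disappear: this already identifies (iii) with (i).  For
    (ii), Pi D = P B with B = S^-1 G invertible, so the normal equations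
    (Pi D)^T (Pi D) theta = (Pi D)^T Pi C lose their projections in the same
    way and become B^T G theta = B^T P^T C.  They are the equations
    G theta = P^T C of (i) premultiplied by the invertible B^T, hence have the
    same solution.  Everything rests on [S] being invertible, which is where
    full column rank and the positivity of sums of squares enter
    ([gram_unitmx]). *)

Set Implicit Arguments.
Unset Strict Implicit.
Unset Printing Implicit Defensive.

Import Order.TTheory GRing.Theory Num.Theory.
Local Open Scope ring_scope.

(** The diagonal entry is the squared Euclidean norm of [u]. *)
Lemma row_mul_tr_eq0 (R : realDomainType) (n : nat) (u : 'rV[R]_n) :
  u *m u^T = 0 -> u = 0.
Proof.
move=> /matrixP/(_ 0 0); rewrite !mxE => /eqP.
rewrite psumr_eq0 => [/allP sq0|i _]; last by rewrite mxE -expr2 sqr_ge0.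
apply/rowP => i; have := sq0 i (mem_index_enum i).
by rewrite !mxE -expr2 sqrf_eq0 => /eqP.
Qed.

(** If [v] annihilates A^T A on the left, then v A^T has norm zero, and the
    columns of [A] are independent. *)
Lemma gram_unitmx (R : realFieldType) (n k : nat) (A : 'M[R]_(n, k)) :
  \rank A = k -> A^T *m A \in unitmx.
Proof.
move=> rkA; rewrite -row_free_unit -kermx_eq0; apply/rowV0P => v /sub_kermxP vS0.
have freeAT : row_free A^T by rewrite /row_free mxrank_tr rkA.
apply: (row_free_inj freeAT); rewrite mul0mx; apply: row_mul_tr_eq0.
by rewrite trmx_mul trmxK mulmxA -(mulmxA v) vS0 mul0mx.
Qed.

Lemma tr_mul_proj_colspan (R : realType) (n k : nat) (A : 'M[R]_(n, k)) :
  A^T *m A \in unitmx -> A^T *m proj_colspan A = A^T.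
Proof. by move=> uS; rewrite /proj_colspan !mulmxA mulmxV ?mul1mx. Qed.

(** Invertible premultiplication does not change the solution of a square
    linear system. *)
Lemma invmx_mull_solve (R : comUnitRingType) (k m : nat) (M G : 'M[R]_k)
    (b : 'M[R]_(k, m)) :
  M \in unitmx -> G \in unitmx ->
  invmx (M *m G) *m (M *m b) = invmx G *m b.
Proof.
move=> uM uG; rewrite -{1}(mulKVmx uG b) (mulmxA M) mulKmx //.
by rewrite unitmx_mul uM.
Qed.

Theorem theorem4p1 (R : realType) (n k : nat) (hkn : (k <= n)%N)
    (P Q : 'M[R]_(n, k)) (C : 'cV[R]_n) (gamma : R)
    (hgamma : 0 <= gamma < 1)
    (hP : \rank P = k)
    (hD : \rank (bellman_diff P Q gamma) = k)
    (hG : \rank (iv_gram P Q gamma) = k) :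
  (* every inverse occurring in the three estimators exists *)
  [/\ P^T *m P \in unitmx,
      iv_gram P Q gamma \in unitmx,
      ls_proj_gram P Q gamma \in unitmx &
      iv_proj_gram P Q gamma \in unitmx] /\
  (* the three estimators coincide *)
  iv_bellman P Q C gamma = ls_proj_bellman P Q C gamma /\
  ls_proj_bellman P Q C gamma = iv_proj_bellman P Q C gamma.
Proof.
have uS := gram_unitmx hP.
have uG : iv_gram P Q gamma \in unitmx.
  by rewrite -row_free_unit /row_free hG.
have PTPi := tr_mul_proj_colspan uS.
have iv_projE : iv_proj_gram P Q gamma = iv_gram P Q gamma.
  by rewrite /iv_proj_gram PTPi.
pose B := invmx (P^T *m P) *m iv_gram P Q gamma.
have uBT : B^T \in unitmx by rewrite unitmx_tr unitmx_mul unitmx_inv uS.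
have PiD : proj_colspan P *m bellman_diff P Q gamma = P *m B.
  by rewrite /B /iv_gram /proj_colspan !mulmxA.
have ls_gramE : ls_proj_gram P Q gamma = B^T *m iv_gram P Q gamma.
  by rewrite /ls_proj_gram PiD (trmx_mul P) -(mulmxA B^T) (mulmxA P^T) /B mulKVmx.
have lsE : ls_proj_bellman P Q C gamma = iv_bellman P Q C gamma.
  rewrite /ls_proj_bellman ls_gramE PiD (trmx_mul P).
  rewrite -(mulmxA B^T) (mulmxA P^T) PTPi.
  exact: invmx_mull_solve.
split; first by split; rewrite // ?iv_projE // ls_gramE unitmx_mul uBT.
by rewrite lsE /iv_proj_bellman iv_projE PTPi.
Qed.
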